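(* Assume $\diamondsuit$, and let $\mathcal F$ be a family of $\aleph_1$ many ladder system colourings (each $\mathbf f\in\mathcal F$ being an $\omega$-colouring of some ladder system, which may depend on $\mathbf f$). Then there is a Suslin tree $T$ such that every $\mathbf f\in\mathcal F$ has a full $T$-uniformization.
   Context: $\diamondsuit$ asserts the existence of $(W_\alpha)_{\alpha<\omega_1}$ with $W_\alpha\subseteq\alpha$ such that for every $X\subseteq\omega_1$ the set $\{\alpha: X\cap\alpha=W_\alpha\}$ is stationary. A ladder system is $\mathbf C=(C_\alpha)_{\alpha\in\lim(\omega_1)}$ with $C_\alpha$ cofinal in $\alpha$ of order type $\omega$; an $\omega$-colouring is $(f_\alpha)$ with $f_\alpha:C_\alpha\to\omega$. For a tree $T$ of height $\omega_1$, $s\upharpoonright\xi$ is the predecessor of $s$ of height $\xi$; a full $T$-uniformization of $\mathbf f$ is a map $\varphi:T\to\omega$ such that for every $s\in T$ of limit height $\alpha$ and all but finitely many $\xi\in C_\alpha$, $\varphi(s\upharpoonright\xi)=f_\alpha(\xi)$. A Suslin tree is a tree of height $\omega_1$ with countable levels and no uncountable chains or antichains. *)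

(* Defs.v *)
From mathcomp Require Import all_boot all_order.
From mathcomp Require Import boolp classical_sets functions cardinality wochoice.

Set Implicit Arguments.
Unset Strict Implicit.
Unset Printing Implicit Defensive.

Import Order.TTheory.

Local Open Scope order_scope.
Local Open Scope classical_set_scope.
Local Open Scope card_scope.

Definition below (d : Order.disp_t) (T : porderType d) (x : T) : set T :=
  [set y | y < x].

Definition order_iso (d d' : Order.disp_t) (T : porderType d)
    (U : porderType d') (A : set T) (B : set U) : Prop :=
  exists f : T -> U,
    set_bij A B f /\ forall x y, A x -> A y -> (x < y <-> f x < f y).

(* [W] is a copy of the ordinal omega_1: these properties determine the order
   type of [W]. The elements of [W] are the countable ordinals, and the ordinal
   [alpha], as the set of its predecessors, is [below alpha]. *)
Definition is_omega1 (d : Order.disp_t) (W : orderType d) : Prop :=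
  [/\ well_order (<=%O : rel W),
      ~ countable [set: W]
    & forall alpha : W, countable (below alpha)].

(* [0] is not counted as a limit ordinal. *)
Definition limit_ord (d : Order.disp_t) (W : orderType d) : set W :=
  [set alpha | below alpha !=set0 /\
    forall beta, beta < alpha -> exists gamma, beta < gamma /\ gamma < alpha].
Arguments limit_ord {d} W.

Definition cofinal_in (d : Order.disp_t) (W : orderType d)
    (A : set W) (alpha : W) : Prop :=
  A `<=` below alpha /\
  forall beta, beta < alpha -> exists gamma, A gamma /\ beta <= gamma.

Definition club (d : Order.disp_t) (W : orderType d) (D : set W) : Prop :=
  (forall beta, exists gamma, D gamma /\ beta <= gamma) /\
  (forall alpha, limit_ord W alpha ->
     cofinal_in (D `&` below alpha) alpha -> D alpha).

Definition stationary (d : Order.disp_t) (W : orderType d) (S : set W) : Prop :=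
  forall D, club D -> S `&` D !=set0.

Definition diamond (d : Order.disp_t) (W : orderType d) : Prop :=
  exists G : W -> set W,
    (forall alpha, G alpha `<=` below alpha) /\
    forall X : set W, stationary [set alpha | X `&` below alpha = G alpha].

Record ladder_system (d : Order.disp_t) (W : orderType d) := LadderSystem {
  ladder :> limit_ord W -> set W ;
  ladderP : forall alpha : limit_ord W,
    cofinal_in (ladder alpha) (val alpha) /\
    order_iso (ladder alpha) [set: nat] }.

Definition colouring (d : Order.disp_t) (W : orderType d)
    (C : ladder_system W) : Type :=
  forall alpha : limit_ord W, C alpha -> nat.

(* Dependent pairs: each colouring comes with its own ladder system. *)
Definition ladder_colouring (d : Order.disp_t) (W : orderType d) : Type :=
  {C : ladder_system W & colouring C}.

Definition is_tree (d : Order.disp_t) (T : porderType d) : Prop :=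
  forall t : T, wo_chain (<=%O : rel T) [pred s | s < t].

Definition has_height (d d' : Order.disp_t) (W : orderType d)
    (T : porderType d') (t : T) (alpha : W) : Prop :=
  order_iso (below t) (below alpha).

Definition level (d d' : Order.disp_t) (W : orderType d) (T : porderType d')
    (alpha : W) : set T := [set t | has_height t alpha].
Arguments level {d d' W} T alpha.

(* The height of a tree is the least ordinal whose level is empty. *)
Definition height_omega1 (d d' : Order.disp_t) (W : orderType d)
    (T : porderType d') : Prop :=
  (forall t : T, exists alpha : W, has_height t alpha) /\
  (forall alpha : W, level T alpha !=set0).

Definition antichain (d : Order.disp_t) (T : porderType d) (A : set T) : Prop :=
  forall x y, A x -> A y -> x <> y -> ~ (x <= y) /\ ~ (y <= x).

Definition suslin_tree (d d' : Order.disp_t) (W : orderType d)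
    (T : porderType d') : Prop :=
  [/\ is_tree T,
      height_omega1 W T,
      forall alpha : W, countable (level T alpha),
      forall A : set T, total_on A <=%O -> countable A
    & forall A : set T, antichain A -> countable A].

(* In a tree, the predecessor of [s] of height [xi] exists and is unique when
   [xi] is smaller than the height of [s]; otherwise [restr s xi] is [s]. *)
Definition restr (d d' : Order.disp_t) (W : orderType d) (T : porderType d')
    (s : T) (xi : W) : T :=
  xget s [set u | u < s /\ has_height u xi].

Definition full_uniformization (d d' : Order.disp_t) (W : orderType d)
    (T : porderType d') (C : ladder_system W) (f : colouring C)
    (phi : T -> nat) : Prop :=
  forall (s : T) (alpha : limit_ord W), has_height s (val alpha) ->
    finite_set [set xi : C alpha | phi (restr s (val xi)) <> f alpha xi].

(* Main.v *)
(** The [omega_1] colourings [f^i] are first amalgamated into one: at a limit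
    [alpha], the ladders of the [f^i] with [i < alpha] are thinned by finite sets
    so that their union [E] is finite below each [beta < alpha], and [v xi] codes
    the finitely many colours required at [xi] in [E]. A function taking the value
    [v xi] at almost all [xi] in [E] uniformizes every [f^i], [i < alpha], at
    [alpha] simultaneously. The limits [alpha <= i] are countably many, and [f^i]
    is uniformized there by a function of the height alone.

    The tree consists of functions into [nat], built by recursion on levels so
    that finitely many values above a node can always be prescribed. At a limit
    [alpha] this lets one continue, through every node below, a branch with value
    [v xi] at almost all [xi] in [E] that in addition meets the set guessed by
    diamond if this set is dense below [alpha]. For an antichain [A] the nodes
    that lie above an element of [A] or are incompatible with all of [A] form a
    dense set; once it is guessed correctly at [alpha], no element of [A] has
    height at least [alpha]. *)

Require Import Defs.
From HB Require Import structures.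
From mathcomp Require Import all_boot all_order.
From mathcomp Require Import boolp classical_sets functions cardinality.
From mathcomp Require Import wochoice.

Set Implicit Arguments.
Unset Strict Implicit.
Unset Printing Implicit Defensive.

Import Order.TTheory.

Local Open Scope order_scope.
Local Open Scope classical_set_scope.
Local Open Scope card_scope.

Lemma countable_enum (T : choiceType) (A : set T) : countable A -> A !=set0 ->
  exists a : nat -> T, (forall n, A (a n)) /\ forall x, A x -> exists n, a n = x.
Proof.
move=> /countable_injP[f f_inj] [x0 Ax0].
exists (fun n => xget x0 [set x | A x /\ f x = n]); split=> [n|x Ax].
  by case: xgetP => [x _ []|].
exists (f x); apply: xget_unique => // y [Ay eq_f].
by apply: f_inj => //; apply/mem_set.
Qed.

(** * Countable ordinals: bounds, clubs, rigidity and coding of pairs *)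

Section Omega1.
Context (d : Order.disp_t) (W : orderType d) (W_omega1 : is_omega1 W).
Implicit Types (alpha beta gamma delta xi : W).

Lemma omega1_min (A : set W) : A !=set0 ->
  exists z, A z /\ forall y, A y -> z <= y.
Proof.
move=> [x Ax]; have [wo _ _] := W_omega1.
have [|z [[Az lb] _]] := wo (fun x => `[<A x>]); first by exists x; apply/asboolP.
exists z; split=> [|y Ay]; first exact/asboolP.
by apply: lb; apply/asboolP.
Qed.

Lemma omega1_wf : well_founded (fun x y : W => x < y).
Proof.
move=> x; apply: contrapT => nAx.
have [z [nAz zmin]] := @omega1_min [set y | ~ Acc (fun x y : W => x < y) y]
  (ex_intro _ x nAx).
apply: nAz; constructor=> y yz; apply: contrapT => nAy.
by have := zmin y nAy; rewrite leNgt yz.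
Qed.

Lemma omega1_ind (P : W -> Prop) :
  (forall x, (forall y, y < x -> P y) -> P x) -> forall x, P x.
Proof. by move=> H x; apply: (well_founded_ind omega1_wf). Qed.

Lemma countable_below alpha : countable (below alpha).
Proof. by case: W_omega1. Qed.

(** Otherwise [W] would be the union of countably many countable closed initial segments. *)
Lemma countable_bounded (A : set W) : countable A ->
  exists b, forall a, A a -> a < b.
Proof.
move=> Ac; apply: contrapT => /forallNP nb; have [_ ucW _] := W_omega1.
apply: ucW; apply: (@sub_countable _ _ _ (\bigcup_(a in A) (below a `|` [set a]))).
  apply: subset_card_le => b _; have := nb b.
  move=> /existsNP[a /not_implyP[Aa /negP]]; rewrite -leNgt le_eqVlt.
  by case/predU1P=> [->|ba]; exists a => //; [right|left].
apply: bigcup_countable => // a _.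
by rewrite -bigcup2E; apply: bigcup_countable => // -[|[|i]] _ //=;
  exact: countable_below.
Qed.

Lemma omega1_gt alpha : exists beta, alpha < beta.
Proof.
by have [b ub] := @countable_bounded [set alpha] (countable1 _); exists b; apply: ub.
Qed.

Lemma countable_le alpha : countable [set beta | beta <= alpha].
Proof.
have [b ab] := omega1_gt alpha.
apply: sub_countable (countable_below b).
by apply: subset_card_le => x /= xa; apply: le_lt_trans ab.
Qed.

Lemma enum_below alpha : below alpha !=set0 -> exists a : nat -> W,
  (forall n, a n < alpha) /\ forall beta, beta < alpha -> exists n, a n = beta.
Proof. exact/countable_enum/countable_below. Qed.

(** For unboundedness, [s n.+1] is taken above [s n] and above all [F z] with [z <= s n]; the
    supremum of the sequence [s] is then closed under [F]. *)
Lemma closure_points_club (F : W -> W) :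
  club [set alpha | limit_ord W alpha /\ forall beta, beta < alpha -> F beta < alpha].
Proof.
split=> [beta|alpha lim_a [_ cof]]; last first.
  split=> // beta ba; have [_ /(_ _ ba)[b' [bb' b'a]]] := lim_a.
  have [gamma [[[_ clos_g] ga] b'g]] := cof _ b'a.
  by apply: lt_trans ga; apply: clos_g; apply: lt_le_trans b'g.
have next x : exists y, x < y /\ forall z, z <= x -> F z < y.
  have cA : countable ([set x] `|` F @` [set z | z <= x]).
    rewrite -bigcup2E; apply: bigcup_countable => // -[|[|i]] _ //=.
    exact: sub_countable (card_image_le _ _) (countable_le x).
  have [y ub] := countable_bounded cA; exists y; split; first by apply: ub; left.
  by move=> z zx; apply: ub; right; exists z.
have [nx nxP] := choice next; pose s n := iter n nx beta.
have cs : countable (range s) by apply: sub_countable (card_image_le _ _) _.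
have [b ub] := countable_bounded cs.
have [alpha [s_lt min_a]] := @omega1_min [set y | forall n, s n < y]
  (ex_intro _ b (fun n => ub _ (ex_intro2 _ _ n I erefl))).
have cofs x : x < alpha -> exists n, x <= s n.
  move=> xa; apply: contrapT => /forallNP h.
  have : alpha <= x by apply: min_a => n; rewrite ltNge; apply/negP/h.
  by rewrite leNgt xa.
exists alpha; split; last exact: ltW (s_lt 0).
split; first split.
- by exists beta; apply: s_lt 0.
- move=> x xa; have [n xn] := cofs _ xa; exists (s n.+1); split=> //.
  by apply: le_lt_trans xn _; exact: (nxP _).1.
move=> x /cofs[n xn]; apply: lt_trans (s_lt n.+1).
exact: (nxP _).2.
Qed.

(** An increasing map moves no point down, and the least point moved up would be missing from the
    range. *)
Lemma order_iso_below_inj alpha beta :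
  order_iso (below alpha) (below beta) -> alpha = beta.
Proof.
move=> [f [[fB f_inj f_surj] f_mono]].
have fge x : x < alpha -> x <= f x.
  elim/omega1_ind: x => x IH xa; rewrite leNgt; apply/negP => fxx.
  have fxa : f x < alpha by apply: lt_trans xa.
  have := IH _ fxx fxa; rewrite leNgt => /negP; apply.
  exact: (f_mono _ _ fxa xa).1.
have fle x : x < alpha -> f x <= x.
  elim/omega1_ind: x => x IH xa; rewrite leNgt; apply/negP => xfx.
  have [|y ya fy] := f_surj x; first exact: lt_trans xfx (fB _ xa).
  have yx : y < x by apply: (f_mono _ _ ya xa).2; rewrite fy.
  by have := IH _ yx ya; rewrite fy leNgt yx.
case: (ltgtP alpha beta) => // [ab|ba].
  by have [x xa fx] := f_surj _ ab; have := fle _ xa; rewrite fx leNgt xa.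
by have := fge _ ba; rewrite leNgt (fB _ ba : f beta < beta).
Qed.

Lemma has_height_inj (d' : Order.disp_t) (T : porderType d') (t : T) alpha beta :
  has_height t alpha -> has_height t beta -> alpha = beta.
Proof.
move=> [f [[fB f_inj f_surj] f_mono]] [g [[gB g_inj g_surj] g_mono]].
apply: order_iso_below_inj.
pose h w := xget t [set s | s < t /\ f s = w].
have hP w : w < alpha -> h w < t /\ f (h w) = w.
  move=> /f_surj[s st fs]; exact: (@xgetPex _ t [set s | s < t /\ f s = w]
    (ex_intro _ s (conj st fs))).
have fK s : s < t -> h (f s) = s.
  move=> st; apply: xget_unique => // u [ut fu].
  by apply: f_inj => //; apply/mem_set.
exists (g \o h); split; last first.
  move=> x y /hP[hx fx] /hP[hy fy]; rewrite -{1}fx -{1}fy -g_mono //.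
  by rewrite -f_mono.
split=> [x /hP[hx _]|x y /set_mem/hP[hx fx] /set_mem/hP[hy fy] /= e|y].
- exact: gB.
- by rewrite -fx -fy; congr (f _); apply: g_inj => //; apply/mem_set.
- move=> /g_surj[s st <-]; exists (f s); first exact: fB.
  by rewrite /= fK.
Qed.

(** By recursion on [beta], [c beta] is an injective sequence avoiding the countably many values
    used before. It will code nodes by elements of [W], so that diamond can guess sets of nodes. *)
Lemma omega1_mul_nat : exists c : W -> nat -> W,
  forall beta m beta' m', c beta m = c beta' m' -> beta = beta' /\ m = m'.
Proof.
pose step beta (rec : forall y, y < beta -> nat -> W) : nat -> W :=
  xget (fun=> beta) [set g | injective g /\
    forall y (h : y < beta) m m', g m <> rec y h m'].
pose c := Fix omega1_wf (fun _ => nat -> W) step.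
have cE beta : c beta = step beta (fun y _ => c y).
  rewrite /c Fix_eq // => x f g fg; congr step.
  by apply/functional_extensionality_dep => y; apply/functional_extensionality_dep.
have cP beta : injective (c beta) /\
    forall y, y < beta -> forall m m', c beta m <> c y m'.
  rewrite cE; apply: (@xgetPex _ (fun=> beta) [set g : nat -> W | injective g /\
    forall y, y < beta -> forall m m', g m <> c y m']).
  pose U := \bigcup_(y in below beta) range (c y).
  have cU : countable U.
    apply: bigcup_countable; first exact: countable_below.
    by move=> y _; apply: sub_countable (card_image_le _ _) _.
  have : infinite_set (~` U).
    move=> /finite_set_countable cCU; have [_ ucW _] := W_omega1; apply: ucW.
    rewrite -(setUv U) -bigcup2E; apply: bigcup_countable => // -[|[|i]] _ //=.
  move=> /infiniteP/card_leP[g].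
  exists (fun n => val (g (to_setT n))); split=> [m n /val_inj e|y yb m m' e].
    by have := 'inj_g (in_setT _) (in_setT _) e => /(congr1 val).
  have := set_valP (g (to_setT m)); apply; exists y => //.
  by exists m'.
exists c => b m b' m' e; case: (ltgtP b b') => [bb'|b'b|eb].
- by case: ((cP b').2 b bb' m' m).
- by case: ((cP b).2 b' b'b m m').
- by subst b'; split=> //; apply: (cP b).1 e.
Qed.

End Omega1.

(** * Trees of functions on closed initial segments *)

Definition agree_lt (d : Order.disp_t) (W : orderType d) (alpha : W)
  (x y : W -> nat) : Prop := forall xi, xi < alpha -> x xi = y xi.

Definition agree_le (d : Order.disp_t) (W : orderType d) (alpha : W)
  (x y : W -> nat) : Prop := forall xi, xi <= alpha -> x xi = y xi.

Definition upd (d : Order.disp_t) (W : orderType d) (x : W -> nat) (alpha : W)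
  (n : nat) : W -> nat := fun xi => if xi == alpha then n else x xi.

Section SequenceTree.
Context (d : Order.disp_t) (W : orderType d) (P : W -> (W -> nat) -> Prop).

(* A node of height [alpha] is a function on the closed interval [0, alpha],
   extended by [0]; [P alpha] constrains its restriction to [below alpha] and
   the value at [alpha] is free. *)
Record seqtree := SeqNode {
  ht : W;
  lab : W -> nat;
  lab_valid : P ht lab;
  lab_support : forall xi, ht < xi -> lab xi = 0 }.

Lemma seqtree_eq (s t : seqtree) : ht s = ht t -> agree_le (ht s) (lab s) (lab t) ->
  s = t.
Proof.
case: s t => [a x px sx] [b y py sy] /= eab; subst b => xy.
have exy : x = y.
  by apply/funext => xi; case: (leP xi a) => [/xy//|axi]; rewrite sx ?sy.
by subst y; congr SeqNode; apply: Prop_irrelevance.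
Qed.

HB.instance Definition _ := gen_eqMixin seqtree.
HB.instance Definition _ := gen_choiceMixin seqtree.

Definition seqtree_le : rel seqtree := fun s t =>
  `[< ht s <= ht t /\ agree_le (ht s) (lab s) (lab t) >].

Lemma seqtree_le_refl : reflexive seqtree_le.
Proof. by move=> s; apply/asboolP. Qed.

Lemma seqtree_le_anti : antisymmetric seqtree_le.
Proof.
move=> s t /andP[/asboolP[st ag] /asboolP[ts _]]; apply: seqtree_eq => //.
by apply/le_anti; rewrite st ts.
Qed.

Lemma seqtree_le_trans : transitive seqtree_le.
Proof.
move=> t s u /asboolP[st st'] /asboolP[tu tu']; apply/asboolP; split.
  exact: le_trans tu.
by move=> xi h; rewrite st' // tu' // (le_trans h).
Qed.

Fact seqtree_display : Order.disp_t. Proof. exact: (Order.Disp tt tt). Qed.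

HB.instance Definition _ := Order.Le_isPOrder.Build seqtree_display seqtree
  seqtree_le_refl seqtree_le_anti seqtree_le_trans.

Lemma seqtree_leE (s t : seqtree) :
  s <= t <-> ht s <= ht t /\ agree_le (ht s) (lab s) (lab t).
Proof. by split=> [/asboolP|h]; last exact/asboolP. Qed.

Lemma seqtree_ltE (s t : seqtree) :
  s < t <-> ht s < ht t /\ agree_le (ht s) (lab s) (lab t).
Proof.
split=> [|[h ag]].
  rewrite lt_neqAle => /andP[/eqP ne /seqtree_leE[h ag]]; split=> //.
  rewrite lt_neqAle h andbT; apply/eqP => e; apply: ne; exact: seqtree_eq.
rewrite lt_neqAle; apply/andP; split; last by apply/seqtree_leE; rewrite ltW.
by apply/eqP => e; rewrite e ltxx in h.
Qed.

Lemma seqtree_le_chain (s t u : seqtree) : s <= u -> t <= u -> ht s <= ht t -> s <= t.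
Proof.
move=> /seqtree_leE[_ su] /seqtree_leE[_ tu] h; apply/seqtree_leE; split=> // xi xs.
by rewrite su // tu // (le_trans xs).
Qed.

Hypothesis W_omega1 : is_omega1 W.
Hypothesis P_ext : forall alpha x y, agree_lt alpha x y -> P alpha x -> P alpha y.
Hypothesis P_down : forall alpha beta x, beta < alpha -> P alpha x -> P beta x.

Definition cut (alpha : W) (x : W -> nat) : W -> nat :=
  fun xi => if xi <= alpha then x xi else 0.

Lemma cutE alpha x : agree_le alpha (cut alpha x) x.
Proof. by move=> xi h; rewrite /cut h. Qed.

Lemma cut_valid alpha x : P alpha x -> P alpha (cut alpha x).
Proof. by apply: P_ext => xi h; rewrite /cut ltW. Qed.

Lemma cut_support alpha x xi : alpha < xi -> cut alpha x xi = 0.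
Proof. by rewrite /cut leNgt => ->. Qed.

Definition mknode alpha x (h : P alpha x) : seqtree :=
  SeqNode (cut_valid h) (@cut_support alpha x).

Lemma seqtree_proj (s : seqtree) xi : xi < ht s ->
  exists u : seqtree, u < s /\ ht u = xi.
Proof.
move=> h; exists (mknode (P_down h (lab_valid s))); split=> //.
apply/seqtree_ltE; split=> //=; exact: cutE.
Qed.

Lemma seqtree_height (s : seqtree) : has_height s (ht s).
Proof.
exists ht; split; last first.
  move=> t u ts us; split=> [/seqtree_ltE[]//|tu].
  rewrite lt_neqAle; apply/andP; split.
    by apply/eqP => e; rewrite e ltxx in tu.
  exact: seqtree_le_chain (ltW ts) (ltW us) (ltW tu).
split=> [t /seqtree_ltE[]//|t u /set_mem/= ts /set_mem/= us e|xi].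
  by apply/le_anti/andP; split; apply: (@seqtree_le_chain _ _ s);
    rewrite ?e // ltW.
by move=> /seqtree_proj[u [us <-]]; exists u.
Qed.

Lemma seqtree_heightE (s : seqtree) alpha : has_height s alpha <-> ht s = alpha.
Proof.
split=> [h|<-]; last exact: seqtree_height.
exact: has_height_inj (seqtree_height s) h.
Qed.

(** Predecessors of one node are ordered by their heights, so a least height gives a least node. *)
Lemma seqtree_tree : is_tree seqtree.
Proof.
move=> t; apply: antisymmetric_wo_chain; first by move=> ? ? _ _; exact: le_anti.
move=> A sA [s As].
have [z [[u [Au <-]] zmin]] := @omega1_min _ _ W_omega1 [set z | exists u, u \in A /\ ht u = z]
  (ex_intro _ _ (ex_intro _ s (conj As erefl))).
exists u; split=> // w Aw; apply: (@seqtree_le_chain _ _ t).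
- exact: ltW (sA _ Au).
- exact: ltW (sA _ Aw).
- by apply: zmin; exists w.
Qed.

Lemma seqtree_restr (s : seqtree) xi : xi < ht s ->
  ht (restr s xi) = xi /\ lab (restr s xi) xi = lab s xi.
Proof.
move=> h; have [us /seqtree_heightE hu] : restr s xi < s /\ has_height (restr s xi) xi.
  apply: (@xgetPex _ s [set u | u < s /\ has_height u xi]).
  have [u [us hu]] := seqtree_proj h.
  by exists u; split=> //; apply/seqtree_heightE.
split=> //; have [_ ->//] := (seqtree_ltE _ _).1 us.
by rewrite hu.
Qed.

Section Countability.
Variable r : W -> nat -> W -> nat.
Hypothesis P_rep : forall alpha x, P alpha x -> exists k, agree_lt alpha x (r alpha k).

(** On a given level a node is determined by the index of a representative and by its top value. *)
Lemma countable_level alpha : countable [set s : seqtree | ht s = alpha].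
Proof.
have rep (s : seqtree) : exists k, agree_lt (ht s) (lab s) (r (ht s) k).
  exact: P_rep (lab_valid s).
have [k kP] := choice rep.
apply/countable_injP; exists (fun s => choice.pickle (k s, lab s (ht s))).
move=> s t /set_mem hs /set_mem ht /(pcan_inj choice.pickleK)[ek el].
apply: seqtree_eq; first by rewrite hs ht.
move=> xi; rewrite le_eqVlt => /predU1P[->|h]; first by rewrite el hs ht.
by rewrite kP // ek hs -ht -kP // ht -hs.
Qed.

Lemma countable_height_lt alpha : countable [set s : seqtree | ht s < alpha].
Proof.
apply: (@sub_countable _ _ _
    (\bigcup_(xi in below alpha) [set s : seqtree | ht s = xi])).
  by apply: subset_card_le => s /= h; exists (ht s).
apply: bigcup_countable => [|xi _]; first exact: countable_below.
exact: countable_level.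
Qed.

End Countability.

Lemma bump_valid (s : seqtree) :
  P (ht s) (upd (lab s) (ht s) (lab s (ht s)).+1).
Proof.
by apply: P_ext (lab_valid s) => xi h; rewrite /upd lt_eqF.
Qed.

Lemma bump_support (s : seqtree) xi : ht s < xi ->
  upd (lab s) (ht s) (lab s (ht s)).+1 xi = 0.
Proof. by move=> h; rewrite /upd gt_eqF // lab_support. Qed.

(* A sibling of [s]: the siblings of the elements of a chain form an antichain. *)
Definition bump (s : seqtree) : seqtree := SeqNode (bump_valid s) (@bump_support s).

Lemma bump_incomp (s t : seqtree) : s < t -> ~ (bump s <= bump t) /\ ~ (bump t <= bump s).
Proof.
move=> /seqtree_ltE[h ag]; split=> /seqtree_leE[/= h' ag']; last first.
  by rewrite leNgt h in h'.
have := ag' _ (lexx _); rewrite /upd eqxx lt_eqF // -ag // => /esym/eqP.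
by rewrite ltn_eqF.
Qed.

Lemma seqtree_chain_countable :
  (forall A : set seqtree, antichain A -> countable A) ->
  forall A : set seqtree, total_on A <=%O -> countable A.
Proof.
move=> ac A tA.
have anti s t : A s -> A t -> s <> t -> ~ (bump s <= bump t) /\ ~ (bump t <= bump s).
  move=> As At ne; have [st|ts] := tA s t As At.
    by apply: bump_incomp; rewrite lt_neqAle st andbT; apply/eqP.
  have [|? ?] := @bump_incomp t s _; last by split.
  by rewrite lt_neqAle ts andbT; apply/eqP => /esym.
have cB : countable (bump @` A).
  apply: ac => _ _ [s As <-] [t At <-] ne; apply: anti => // e.
  by apply: ne; rewrite e.
have /countable_injP[f f_inj] := cB; apply/countable_injP; exists (f \o bump).
move=> s t /set_mem As /set_mem At fst.
have e : bump s = bump t.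
  by apply: f_inj => //; apply/mem_set; [exists s|exists t].
by apply: contrapT => /(anti _ _ As At)[+ _]; rewrite e => /(_ (lexx _)).
Qed.

End SequenceTree.

Lemma finite_bound (d : Order.disp_t) (W : orderType d) (A : set W) (beta gamma : W) :
  finite_set A -> (forall xi, A xi -> xi < gamma) -> beta < gamma ->
  exists delta, [/\ beta <= delta, delta < gamma & forall xi, A xi -> xi <= delta].
Proof.
move=> /finite_seqP[s ->] {A}; elim: s => [|x s IH] lt_s bg; first by exists beta.
have [|//|delta [bd dg ub]] := IH; first by move=> xi h; apply: lt_s; rewrite /= inE h orbT.
exists (Order.max delta x); split.
- by rewrite le_max bd.
- by rewrite gt_max dg; apply: lt_s; rewrite /= mem_head.
move=> xi; rewrite /= inE le_max => /predU1P[->|/ub->//]; by rewrite lexx orbT.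
Qed.

(** * Recursive construction of the levels *)

Section Construction.
Context (d : Order.disp_t) (W : orderType d) (W_omega1 : is_omega1 W).
Variables (G : W -> set W) (E : W -> set W) (v : W -> W -> nat).
Hypothesis E_fin : forall alpha beta, beta < alpha ->
  finite_set [set xi | E alpha xi /\ xi <= beta].
Variable c : W -> nat -> W.
Variable e : W -> nat -> W * nat * nat.
Hypothesis e_lt : forall alpha, below alpha !=set0 -> forall k, (e alpha k).1.1 < alpha.
Hypothesis e_surj : forall alpha delta j n, delta < alpha ->
  exists k, e alpha k = (delta, j, n).
Implicit Types (alpha beta gamma delta xi : W) (x y b : W -> nat).

Definition represented (r : nat -> W -> nat) alpha x := exists k, agree_lt alpha x (r k).

(** Membership of the node [x] of height [beta] in the set guessed at [alpha]: the code of the node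
    consists of an index [k] representing it below [beta] and its top value. *)
Definition guessed alpha (r : nat -> W -> nat) beta x :=
  exists k, G alpha (c beta (choice.pickle (k, x beta))) /\ agree_lt beta x (r k).

Definition guess_dense alpha (rec : forall beta, beta < alpha -> nat -> W -> nat) :=
  forall beta (h : beta < alpha) y, represented (rec beta h) beta y ->
  exists beta' (h' : beta' < alpha) y', [/\ beta <= beta',
    represented (rec beta' h') beta' y', agree_le beta y y' &
    guessed alpha (rec beta' h') beta' y'].

(** [rec] stands for the levels already built, so that the requirement can be used inside the
    recursion. *)
Definition good_branch_rec alpha (rec : forall beta, beta < alpha -> nat -> W -> nat) b :=
  (forall beta (h : beta < alpha), represented (rec beta h) beta b) /\
  (limit_ord W alpha ->
    (exists zeta, zeta < alpha /\
       forall xi, E alpha xi -> zeta < xi -> xi < alpha -> b xi = v alpha xi) /\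
    (guess_dense rec -> exists beta (h : beta < alpha), guessed alpha (rec beta h) beta b)).

(** A triple [(delta, j, n)] listed by [e alpha] names the node of height [delta] that follows
    branch [j] and has top value [n]; the chosen [b] continues this node. At the least element of
    [W] no such node exists and the default, the zero function, is taken. *)
Definition branch_step alpha (rec : forall beta, beta < alpha -> nat -> W -> nat) :
    nat -> W -> nat :=
  fun k => xget (fun=> 0) [set b | good_branch_rec rec b /\
    exists h : (e alpha k).1.1 < alpha,
      agree_le (e alpha k).1.1 b
        (upd (rec _ h (e alpha k).1.2) (e alpha k).1.1 (e alpha k).2)].

(* [branch alpha k], for [k] in [nat], are the branches through the levels below
   [alpha] that are continued at level [alpha]: one for each node below. *)
Definition branch : W -> nat -> W -> nat :=
  Fix (omega1_wf W_omega1) (fun _ => nat -> W -> nat) branch_step.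

Lemma branchE alpha : branch alpha = branch_step (fun beta (_ : beta < alpha) => branch beta).
Proof.
rewrite /branch Fix_eq // => x f g fg; congr branch_step.
by apply/functional_extensionality_dep => y; apply/functional_extensionality_dep.
Qed.

Definition admissible alpha x := represented (branch alpha) alpha x.

Definition good_branch alpha b := good_branch_rec (fun beta (_ : beta < alpha) => branch beta) b.

Lemma admissible_ext alpha x y : agree_lt alpha x y -> admissible alpha x -> admissible alpha y.
Proof. by move=> xy [k xk]; exists k => xi h; rewrite -xy // xk. Qed.

Lemma admissible_branch alpha k : admissible alpha (branch alpha k).
Proof. by exists k. Qed.

Lemma good_branch_ext alpha x y : agree_lt alpha x y -> good_branch alpha x -> good_branch alpha y.
Proof.
move=> xy [px lx]; split=> [beta h|lim].
  by apply: admissible_ext (px _ h) => xi xb; apply: xy; apply: lt_trans h.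
have [[zeta [za zP]] mx] := lx lim; split.
  by exists zeta; split=> // xi Exi zx xa; rewrite -xy // zP.
move=> /mx[beta [h [k [Gk ag]]]]; exists beta, h, k; rewrite -xy //; split=> //.
by move=> xi xb; rewrite -xy ?ag // (lt_trans xb).
Qed.

(** This keeps the choice in [branch_step] from falling back on its default at [gamma]; it is
    established for every [gamma] in [extendible_all]. *)
Definition extendible gamma := forall delta y, delta < gamma -> admissible delta y ->
  exists b, good_branch gamma b /\ agree_le delta b y.

Lemma admissible_upd delta j n : admissible delta (upd (branch delta j) delta n).
Proof. by exists j => xi h; rewrite /upd lt_eqF. Qed.

Lemma branch_spec gamma k : extendible gamma -> below gamma !=set0 ->
  good_branch gamma (branch gamma k) /\
  agree_le (e gamma k).1.1 (branch gamma k)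
    (upd (branch (e gamma k).1.1 (e gamma k).1.2) (e gamma k).1.1 (e gamma k).2).
Proof.
move=> ex ne; have h := e_lt ne k.
have [b [okb agb]] := ex _ _ h (admissible_upd (e gamma k).1.1 (e gamma k).1.2 (e gamma k).2).
rewrite [in good_branch _ _]branchE [in agree_le _ _ _]branchE /branch_step.
by case: xgetP => [b' _ [? [? ?]] //|/(_ b) []]; split=> //; exists h.
Qed.

Lemma admissible_good_branch gamma x : extendible gamma -> below gamma !=set0 ->
  admissible gamma x -> good_branch gamma x.
Proof.
move=> ex ne [k xk]; have [+ _] := branch_spec k ex ne.
by apply: good_branch_ext => xi h; rewrite xk.
Qed.

Lemma admissible_down_of gamma beta x : extendible gamma -> beta < gamma ->
  admissible gamma x -> admissible beta x.
Proof.
move=> ex bg px; have [+ _] := admissible_good_branch ex (ex_intro (below gamma) _ bg) px.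
exact.
Qed.

(** Induction on [gamma]: the points of [A] below [gamma] are bounded by some [delta < gamma], and
    their values are prescribed first on a node of height [delta]. Some branch at [gamma] continues
    that node, and the value at [gamma] itself is free. *)
Lemma prescribe_of gamma : (forall beta, beta <= gamma -> extendible beta) ->
  forall beta x (A : set W) w, beta <= gamma -> admissible beta x -> finite_set A ->
  (forall xi, A xi -> beta < xi <= gamma) ->
  exists y, [/\ admissible gamma y, agree_le beta y x & forall xi, A xi -> y xi = w xi].
Proof.
elim/(omega1_ind W_omega1): gamma => gamma IH ex beta x A w.
rewrite le_eqVlt => /predU1P[-> px _ Alt|bg px finA Alt].
  exists x; split=> // xi /Alt/andP[h1 h2].
  by have := lt_le_trans h1 h2; rewrite ltxx.
have finA' : finite_set (A `&` below gamma) by apply: finite_setIl.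
have [|delta [bd dg ub]] := finite_bound finA' _ bg; first by move=> xi [].
have [|y0 [p0 ag0 w0]] := IH _ dg (fun z zd => ex z (le_trans zd (ltW dg)))
    beta x (A `&` below gamma) w bd px finA'.
  by move=> xi h; rewrite (ub _ h) andbT; have [/Alt/andP[]] := h.
have [j yj] := p0.
have [k ek] := e_surj j (y0 delta) dg.
have [_ agk] := branch_spec k (ex _ (lexx _)) (ex_intro (below gamma) _ dg).
rewrite ek /= in agk.
have agy xi : xi <= delta -> branch gamma k xi = y0 xi.
  move=> h; rewrite agk // /upd; case: eqVneq => [->//|ne].
  by rewrite yj // lt_neqAle ne.
exists (upd (branch gamma k) gamma (w gamma)); split.
- exact: admissible_upd.
- move=> xi xb; rewrite /upd lt_eqF ?(le_lt_trans xb) // agy ?ag0 //.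
  exact: le_trans bd.
- move=> xi Axi; rewrite /upd; case: eqVneq => [->//|ne].
  have xg : xi < gamma by rewrite lt_neqAle ne; have /andP[] := Alt _ Axi.
  by rewrite agy ?w0 //; apply: ub.
Qed.

(** The node is extended in countably many steps whose heights reach every ordinal below [gamma].
    Each step meets only finitely many new points of [E gamma], so [prescribe_of] can give them the
    values wanted; [b] is the union of the nodes obtained. *)
Lemma fusion gamma delta y : (forall beta, beta < gamma -> extendible beta) ->
  delta < gamma -> admissible delta y ->
  exists b, [/\ forall beta, beta < gamma -> admissible beta b, agree_le delta b y &
    forall xi, E gamma xi -> delta < xi -> xi < gamma -> b xi = v gamma xi].
Proof.
move=> ex dg py.
have [a [a_lt a_surj]] := enum_below W_omega1 (ex_intro (below gamma) _ dg).
pose inv (p : W * (W -> nat)) := [/\ delta <= p.1, p.1 < gamma & admissible p.1 p.2].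
(* The implication makes the step total, as [choice] requires; outside [inv] any pair serves. *)
have next (np : nat * (W * (W -> nat))) : exists q, inv np.2 ->
    [/\ inv q, np.2.1 <= q.1, a np.1 <= q.1, agree_le np.2.1 q.2 np.2.2 &
      forall xi, E gamma xi -> np.2.1 < xi -> xi <= q.1 -> q.2 xi = v gamma xi].
  case: np => n [beta x]; have [[/= db bg px]|ni] := pselect (inv (beta, x)); last first.
    by exists (beta, x).
  pose eps := Order.max beta (a n).
  have eg : eps < gamma by rewrite gt_max bg a_lt.
  have be : beta <= eps by rewrite le_max lexx.
  have [|||z [pz agz vz]] := @prescribe_of eps _ beta x
    [set xi | (E gamma xi /\ xi <= eps) /\ beta < xi] (v gamma) be px.
  - by move=> z ze; apply: ex; apply: le_lt_trans eg.
  - exact/finite_setIl/E_fin.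
  - by move=> xi [[_ ->] ->].
  exists (eps, z) => _; split=> //=.
  - by split=> //=; apply: le_trans be.
  - by rewrite le_max lexx orbT.
  - by move=> xi Exi bx xe; apply: vz.
have [nx nxP] := choice next.
pose s := nat_rect (fun=> (W * (W -> nat))%type) (delta, y) (fun n p => nx (n, p)).
have s_inv n : inv (s n).
  by elim: n => [|n IH] //=; have [] := nxP (n, s n) IH.
have sP n := nxP (n, s n) (s_inv n).
have s_mono m n : (s m).1 <= (s (m + n)%N).1 /\ agree_le (s m).1 (s (m + n)%N).2 (s m).2.
  elim: n => [|n [IH1 IH2]]; first by rewrite addn0.
  rewrite addnS; have [_ /= h1 _ h2 _] := sP (m + n)%N; split; first exact: le_trans h1.
  by move=> xi xm; rewrite h2 ?IH2 // (le_trans xm).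
have s_coh m n xi : xi <= (s m).1 -> xi <= (s n).1 -> (s m).2 xi = (s n).2 xi.
  move=> hm hn; have [mn|/ltnW nm] := leqP m n.
    by have [_ +] := s_mono m (n - m)%N; rewrite subnKC // => ->.
  by have [_ +] := s_mono n (m - n)%N; rewrite subnKC // => ->.
have idx xi : exists n, xi < gamma -> xi <= (s n).1.
  have [xg|] := pselect (xi < gamma); last by exists 0.
  by have [n <-] := a_surj _ xg; exists n.+1 => _; have [] := sP n.
have [ix ixP] := choice idx.
have s_v n xi : E gamma xi -> delta < xi -> xi <= (s n).1 -> (s n).2 xi = v gamma xi.
  elim: n => [|n IH] Exi dx xs /=; first by have := lt_le_trans dx xs; rewrite ltxx.
  have [_ /= _ _ h2 h3] := sP n; case: (leP xi (s n).1) => xn; last exact: h3.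
  by rewrite h2 // IH.
pose b xi := (s (ix xi)).2 xi.
have bs n : agree_le (s n).1 b (s n).2.
  move=> xi xn; apply: s_coh => //; apply: ixP; apply: le_lt_trans xn _.
  by have [] := s_inv n.
exists b; split.
(* The node of stage [ix beta] has height at least [beta] and agrees with [b] up to its height, so
   admissibility passes from it to [b]. *)
- move=> beta bg; have := ixP _ bg; have [_ sg ps] := s_inv (ix beta).
  rewrite le_eqVlt => /predU1P[->|h].
    by apply: admissible_ext ps => xi h; rewrite (bs (ix beta)) // ltW.
  have := admissible_down_of (ex _ sg) h ps.
  by apply: admissible_ext => xi xb; rewrite (bs (ix beta)) // ltW // (lt_trans xb).
- exact: (bs 0).
- by move=> xi Exi dx xg; apply: s_v => //; apply: ixP.
Qed.

(** If [gamma] has a largest predecessor, it suffices to extend the node to that height; limits are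
    handled by [fusion]. *)
Lemma extendible_all gamma : extendible gamma.
Proof.
elim/(omega1_ind W_omega1): gamma => gamma ex delta y dg py.
have [lim|nlim] := pselect (limit_ord W gamma); last first.
  have [beta [bg bmax]] : exists beta, beta < gamma /\ forall xi, xi < gamma -> xi <= beta.
    apply: contrapT => /forallNP h; apply: nlim; split; first by exists delta.
    move=> beta bg; apply: contrapT => /forallNP h'; apply: (h beta); split=> // xi xg.
    by rewrite leNgt; apply/negP => bx; apply: (h' xi).
  have [|||b [pb agb _]] := @prescribe_of beta _ delta y set0 (fun=> 0) (bmax _ dg) py.
  - by move=> z zb; apply: ex; apply: le_lt_trans bg.
  - exact: finite_set0.
  - by [].
  exists b; split=> //; split=> // z /bmax; rewrite le_eqVlt => /predU1P[->//|zb].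
  exact: admissible_down_of (ex _ bg) zb pb.
(* If the guessed set is dense below [gamma], [y] is first extended to a node in it; otherwise [y]
   is kept. *)
have [d1 [y1 [dd1 d1g p1 ag1 gu1]]] : exists d1 y1, [/\ delta <= d1, d1 < gamma,
    admissible d1 y1, agree_le delta y y1 &
    guess_dense (fun beta (_ : beta < gamma) => branch beta) ->
    guessed gamma (branch d1) d1 y1].
  have [den|nden] := pselect (guess_dense (fun beta (_ : beta < gamma) => branch beta)).
    by have [d1 [h [y1 [? ? ? ?]]]] := den _ dg _ py; exists d1, y1.
  by exists delta, y.
have [b [pb agb vb]] := fusion ex d1g p1.
exists b; split; last by move=> xi h; rewrite agb ?ag1 // (le_trans h).
split=> // _; split; first by exists d1.
move=> /gu1[k [Gk agk]]; exists d1, d1g, k; rewrite agb //; split=> // xi h.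
by rewrite agb ?agk // ltW.
Qed.

Lemma admissible_down gamma beta x : beta < gamma -> admissible gamma x -> admissible beta x.
Proof. exact/admissible_down_of/extendible_all. Qed.

(** * Countability of antichains and the Suslin property *)

Hypothesis c_inj : forall beta m beta' m', c beta m = c beta' m' -> beta = beta' /\ m = m'.
Hypothesis G_guess : forall X : set W,
  stationary [set alpha | X `&` below alpha = G alpha].

Local Notation T := (seqtree admissible).

Lemma mknode_lab (s : T) k :
  agree_lt (ht s) (lab s) (branch (ht s) k) ->
  mknode admissible_ext (admissible_upd (ht s) k (lab s (ht s))) = s.
Proof.
move=> ag; apply: seqtree_eq => //= xi h; rewrite cutE // /upd.
by case: eqVneq => [->//|ne]; rewrite ag // lt_neqAle ne.
Qed.

Lemma admissible_antichain_countable (A : set T) : antichain A -> countable A.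
Proof.
move=> antiA.
pose X := [set t : T | (exists2 a, A a & a <= t) \/
  (forall a u : T, A a -> a <= u -> t <= u -> False)].
have denX (t : T) : exists u : T, t <= u /\ X u.
  have [[a [u [Aa au tu]]]|h] := pselect (exists a u : T, [/\ A a, a <= u & t <= u]).
    by exists u; split=> //; left; exists a.
  by exists t; split=> //; right=> a u Aa au tu; apply: h; exists a, u.
have [ext extP] := choice denX.
pose nd beta k n : T := mknode admissible_ext (admissible_upd beta k n).
(* The dense set [X] is transferred to a subset of [W] through the codes of its nodes. *)
pose X' := [set w | exists beta k n, w = c beta (choice.pickle (k, n)) /\ X (nd beta k n)].
have XE beta k n : X' (c beta (choice.pickle (k, n))) <-> X (nd beta k n).
  split=> [[beta' [k' [n' [/c_inj[<- /(pcan_inj choice.pickleK)[<- <-]]]]]] //|h].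
  by exists beta, k, n.
(* When [alpha] is closed under [F], nodes of height below [alpha] have codes below [alpha], and
   [ext] keeps their heights below [alpha]. Hence density of [X] reflects to density below
   [alpha]. *)
have Fex beta : exists z, (forall m, c beta m < z) /\
    (forall t : T, ht t = beta -> ht (ext t) < z).
  have cS : countable (range (c beta) `|` (fun t : T => ht (ext t)) @` [set t : T | ht t = beta]).
    rewrite -bigcup2E; apply: bigcup_countable => // -[|[|i]] _ //=.
      exact: sub_countable (card_image_le _ _) _.
    apply: sub_countable (card_image_le _ _) _.
    by apply: (@countable_level _ _ _ branch).
  have [z ub] := countable_bounded W_omega1 cS; exists z; split.
    by move=> m; apply: ub; left; exists m.
  by move=> t h; apply: ub; right; exists t.
have [F FP] := choice Fex.
have [alpha [/= gua [lim clo]]] := G_guess X' (closure_points_club W_omega1 F).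
apply: sub_countable (@countable_height_lt _ _ admissible W_omega1 branch (fun _ _ => id) alpha).
apply: subset_card_le => s As /=; rewrite ltNge; apply/negP => als.
(* A node [s] of height at least [alpha] induces an admissible branch below [alpha], which must meet
   the guessed set. *)
have pas : admissible alpha (lab s).
  move: als; rewrite le_eqVlt => /predU1P[->|h]; first exact: lab_valid.
  exact: admissible_down h (lab_valid s).
have [_ /(_ lim)[_]] := admissible_good_branch (@extendible_all alpha) lim.1 pas.
case.
  move=> beta h y [k yk]; pose t := nd beta k (y beta).
  have [tu Xu] := extP t; set u := ext t in tu Xu.
  have ua : ht u < alpha by apply: lt_trans (clo _ h); apply: (FP _).2.
  exists (ht u), ua, (lab u); have [bu agu] := (seqtree_leE _ _).1 tu.
  split=> //; first exact: (lab_valid u).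
    move=> xi xb; rewrite -agu //= cutE // /upd; case: eqVneq => [->//|ne].
    by rewrite yk // lt_neqAle ne.
  have [k' uk'] := lab_valid u; exists k'; split=> //.
  rewrite -gua; split; first by apply/XE; rewrite /nd mknode_lab.
  by apply: lt_trans (clo _ ua); apply: (FP _).1.
move=> beta [h [k [Gk agk]]].
have [/XE Xn _] : (X' `&` below alpha) (c beta (choice.pickle (k, lab s beta))).
  by rewrite gua.
have bs : beta < ht s by apply: lt_le_trans als.
have lt_ns : nd beta k (lab s beta) < s.
  apply/seqtree_ltE; split=> //= xi xb; rewrite cutE // /upd.
  by case: eqVneq => [->//|ne]; rewrite agk // lt_neqAle ne.
(* The node of [X] found below [s] either extends some [a] in [A], which is then strictly below [s],
   or is incompatible with all of [A] although [s] itself extends it. *)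
case: Xn => [[a Aa an]|/(_ s s As (lexx _) (ltW lt_ns))//].
have as_ : a < s by apply: le_lt_trans lt_ns.
have [|+ _] := antiA a s Aa As; first by move=> eas; rewrite eas ltxx in as_.
by rewrite ltW.
Qed.

Lemma admissible_suslin : suslin_tree W T.
Proof.
split.
- exact: seqtree_tree.
- split=> [t|alpha].
    by exists (ht t); apply: seqtree_height => //; [exact: admissible_ext|exact: admissible_down].
  exists (mknode admissible_ext (admissible_branch alpha 0)); apply: seqtree_height.
  + exact: admissible_ext.
  + exact: admissible_down.
- move=> alpha; apply: sub_countable (@countable_level _ _ admissible branch (fun _ _ => id) alpha).
  apply: subset_card_le => s /=; rewrite /level /= seqtree_heightE //.
  + exact: admissible_ext.
  + exact: admissible_down.
- exact/(seqtree_chain_countable admissible_ext)/admissible_antichain_countable.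
- exact: admissible_antichain_countable.
Qed.

Lemma admissible_limit (s : T) : limit_ord W (ht s) -> exists zeta, zeta < ht s /\
  forall xi, E (ht s) xi -> zeta < xi -> xi < ht s -> lab s xi = v (ht s) xi.
Proof.
move=> lim; have [_ /(_ lim)[]//] := admissible_good_branch (@extendible_all _) lim.1 (lab_valid s).
Qed.

End Construction.

Lemma finite_inj_bounded (T : Type) (A : set T) (f : T -> nat) (N : nat) :
  {in A &, injective f} -> (forall x, A x -> (f x <= N)%N) -> finite_set A.
Proof.
move=> f_inj fN; rewrite -(eq_finite_set (inj_card_eq f_inj)).
apply: sub_finite_set (finite_II N.+1) => _ [x Ax <-]; exact: fN.
Qed.

(** * Ladders, their almost disjointness, and finite codes *)

Section Ladders.
Context (d : Order.disp_t) (W : orderType d) (W_omega1 : is_omega1 W).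
Implicit Types (alpha beta gamma delta xi i : W) (f : ladder_colouring W).

(** Totalized by the empty set off the limits, so that ladders are indexed by plain elements of [W];
    [col] is totalized by 0 in the same way. *)
Definition lad f alpha : set W :=
  oapp (fun a : limit_ord W => projT1 f a) set0 (insub alpha).

Definition col f alpha xi : nat :=
  oapp (fun a : limit_ord W => oapp (projT2 f a) 0 (insub xi)) 0 (insub alpha).

Lemma ladE f (a : limit_ord W) : lad f (val a) = projT1 f a.
Proof. by rewrite /lad valK. Qed.

Lemma colE f (a : limit_ord W) (xi : projT1 f a) : col f (val a) (val xi) = projT2 f a xi.
Proof. by rewrite /col valK /= valK. Qed.

Lemma lad_lt f alpha xi : lad f alpha xi -> xi < alpha.
Proof.
rewrite /lad; case: insubP => //= a _ <- Cx.
by have [[sub _] _] := ladderP (projT1 f) a; apply: sub Cx.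
Qed.

Lemma lad_fin f alpha beta : beta < alpha ->
  finite_set [set xi | lad f alpha xi /\ xi <= beta].
Proof.
rewrite /lad; case: insubP => [a _ <- ba|_ _] /=; last first.
  by apply: sub_finite_set (finite_set0 _) => xi [].
have [[sub cof] [h [[hB h_inj h_surj] h_mono]]] := ladderP (projT1 f) a.
have [gamma [Cg bg]] := cof _ ba.
apply: (@finite_inj_bounded _ _ h (h gamma)).
  by move=> x y /set_mem[Cx _] /set_mem[Cy _]; apply: h_inj; apply/mem_set.
move=> x [Cx xb]; have := le_trans xb bg.
rewrite le_eqVlt => /predU1P[->//|/(h_mono _ _ Cx Cg)].
by rewrite ltEnat => /ltnW.
Qed.

Lemma lad_bound f alpha beta gamma : alpha <> beta -> gamma < beta ->
  exists zeta, zeta < beta /\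
    forall xi, zeta < xi -> xi < beta -> ~ lad f alpha xi.
Proof.
move=> ne gb; case: (ltgtP alpha beta) => // [ab|ba].
  by exists alpha; split=> // xi ax _ /lad_lt xa; have := lt_trans ax xa; rewrite ltxx.
have [|||z [_ zb ub]] := @finite_bound _ _ [set xi | lad f alpha xi /\ xi < beta] gamma beta.
- by apply: sub_finite_set (lad_fin f ba) => xi [? /ltW].
- by move=> xi [].
- by [].
by exists z; split=> // xi zx xb ax; have := ub xi (conj ax xb); rewrite leNgt zx.
Qed.

(* Almost disjointness of the ladders: at [xi], copy the colour of the ladder
   through [xi] that comes first in an enumeration of the ordinals up to [beta]. *)
Lemma countable_uniformization f beta : exists g : W -> nat, forall alpha,
  limit_ord W alpha -> alpha <= beta ->
  exists zeta, zeta < alpha /\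
    forall xi, lad f alpha xi -> zeta < xi -> g xi = col f alpha xi.
Proof.
have /countable_injP[e e_inj] := countable_le W_omega1 beta.
have first xi : exists a, (exists2 a', a' <= beta & lad f a' xi) ->
    [/\ a <= beta, lad f a xi & forall a', a' <= beta -> lad f a' xi -> (e a <= e a')%N].
  have [[a' a'b la']|] := pselect (exists2 a', a' <= beta & lad f a' xi); last by exists xi.
  pose Q n := `[< exists a, [/\ a <= beta, lad f a xi & e a = n] >].
  have exQ : exists n, Q n by exists (e a'); apply/asboolP; exists a'.
  case: (ex_minnP exQ) => n /asboolP[a [ab la en]] nmin; exists a => _; split=> //.
  by move=> z zb lz; rewrite en; apply: nmin; apply/asboolP; exists z.
have [a aP] := choice first; exists (fun xi => col f (a xi) xi) => alpha [[b0 b0a] _] ab.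
(* Induction on the position of [alpha] in the enumeration: each of the finitely many ordinals
   placed before it has a ladder avoiding an end segment of [alpha]. *)
have [zeta [za zP]] : exists zeta, zeta < alpha /\ forall a', a' <= beta -> a' <> alpha ->
    (e a' < e alpha)%N -> forall xi, zeta < xi -> xi < alpha -> ~ lad f a' xi.
  elim: (e alpha) => [|N [z [za zP]]]; first by exists b0.
  have [[a' [a'b a'a ea']]|nx] :=
    pselect (exists a', [/\ a' <= beta, a' <> alpha & e a' = N]); last first.
    exists z; split=> // a' a'b a'a; rewrite ltnS leq_eqVlt => /predU1P[ea'|]; last exact: zP.
    by case: nx; exists a'.
  have [z' [z'a z'P]] := lad_bound f a'a b0a.
  exists (Order.max z z'); split; first by rewrite gt_max za.
  move=> a2 a2b a2a; rewrite ltnS leq_eqVlt => /predU1P[ea2|lt2] xi; last first.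
    by rewrite gt_max => /andP[zx _]; apply: zP.
  have -> : a2 = a' by apply: e_inj; rewrite ?ea2 //; apply/mem_set.
  by rewrite gt_max => /andP[_ z'x]; apply: z'P.
exists zeta; split=> // xi lx zx; congr (col f _ xi); apply: contrapT => ne.
have [|axb lax amin] := aP xi; first by exists alpha.
have := amin _ ab lx; rewrite leq_eqVlt => /predU1P[ea|lt].
  by apply: ne; apply: e_inj => //; apply/mem_set.
exact: zP axb ne lt _ zx (lad_lt lx) lax.
Qed.

(** The number codes a finite list with entry [w i] at position [e i], where [e] is injective on
    [A]. *)
Lemma decoding (A : set W) : countable A -> exists dec : nat -> W -> nat,
  forall (J : set W) (w : W -> nat), J `<=` A -> finite_set J ->
  exists n, forall i, J i -> dec n i = w i.
Proof.
move=> /countable_injP[e e_inj].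
exists (fun n i => nth 0 (odflt [::] (choice.unpickle n : option (seq nat))) (e i)).
move=> J w + /finite_seqP[s Js]; rewrite {}Js => sA.
suff [l lP] : exists l : seq nat, forall i, i \in s -> nth 0 l (e i) = w i.
  by exists (choice.pickle l) => i si; rewrite choice.pickleK /= lP.
elim: s sA => [|x s IH] sA; first by exists [::].
have [|l lP] := IH; first by move=> i si; apply: sA; rewrite /= inE si orbT.
exists (set_nth 0 l (e x) (w x)) => i xsi; rewrite nth_set_nth /=.
case: eqVneq => [ei|ne].
  by congr w; apply/esym/e_inj => //; apply/mem_set/sA; rewrite //= mem_head.
by move: xsi; rewrite inE => /predU1P[ix|/lP//]; rewrite ix eqxx in ne.
Qed.

End Ladders.

(** * Amalgamation of the family into one ladder and one colour at each limit *)

Section Amalgamation.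
Context (d : Order.disp_t) (W : orderType d) (W_omega1 : is_omega1 W).
Variable fam : W -> ladder_colouring W.
Variable en : W -> W -> nat.
Hypothesis en_inj : forall alpha, {in below alpha &, injective (en alpha)}.
Implicit Types (alpha beta xi i : W).

(* The number of [i < alpha] that are counted at [xi] is finite, as it is bounded
   in terms of [en alpha xi], while each [i] is counted at all large [xi]. *)
Definition counted alpha i xi :=
  forall eta, xi <= eta -> eta < alpha -> (en alpha i <= en alpha eta)%N.

(** The condition [i < xi] is there because colours are decoded at [xi] by [dec xi], which knows
    only the indices below [xi] and does not depend on [alpha]. *)
Definition amalgam alpha : set W :=
  [set xi | exists i, [/\ i < xi, xi < alpha, counted alpha i xi & lad (fam i) alpha xi]].

Lemma counted_fin alpha xi : xi < alpha ->
  finite_set [set i | i < alpha /\ (en alpha i <= en alpha xi)%N].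
Proof.
move=> xa; apply: (@finite_inj_bounded _ _ (en alpha) (en alpha xi)); last by move=> i [].
by move=> i j /set_mem[ia _] /set_mem[ja _]; apply: en_inj; apply/mem_set.
Qed.

(** Only finitely many [eta < alpha] come no later than [i] in the enumeration [en alpha]; beyond
    all of them [i] is counted. *)
Lemma counted_large alpha i : i < alpha -> exists zeta, [/\ i <= zeta, zeta < alpha &
  forall xi, zeta < xi -> counted alpha i xi].
Proof.
move=> ia; have [|zeta [iz za ub]] := finite_bound (counted_fin ia) _ ia.
  by move=> xi [].
exists zeta; split=> // xi zx eta xe ea; rewrite leqNgt; apply/negP => /ltnW lt.
have := ub _ (conj ea lt); rewrite leNgt => /negP; apply.
exact: lt_le_trans xe.
Qed.

Lemma amalgam_fin alpha beta : beta < alpha ->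
  finite_set [set xi | amalgam alpha xi /\ xi <= beta].
Proof.
move=> ba.
(* An [i] counted at some [xi <= beta] satisfies the inequality at [eta = beta], so only finitely
   many ladders contribute. *)
apply: (@sub_finite_set _ _ (\bigcup_(i in [set i | i < alpha /\ (en alpha i <= en alpha beta)%N])
    [set xi | lad (fam i) alpha xi /\ xi <= beta])).
  move=> xi [[i [ix xa ci li]] xb]; exists i => //=; split; first exact: lt_trans xa.
  exact: ci.
by apply: bigcup_finite => [|i _]; [exact: counted_fin|exact: lad_fin].
Qed.

Variable dec : W -> nat -> W -> nat.
Hypothesis decP : forall xi (J : set W) (w : W -> nat), J `<=` below xi -> finite_set J ->
  exists n, forall i, J i -> dec xi n i = w i.

Lemma amalgam_colour alpha xi : exists n, xi < alpha -> forall i, i < xi ->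
  counted alpha i xi -> dec xi n i = col (fam i) alpha xi.
Proof.
have [xa|nxa] := pselect (xi < alpha); last by exists 0.
have [||n nP] := @decP xi [set i | i < xi /\ counted alpha i xi] (fun i => col (fam i) alpha xi).
- by move=> i [].
- apply: sub_finite_set (counted_fin xa) => i [ix ci]; split; first exact: lt_trans xa.
  exact: ci.
- by exists n => _ i ix ci; apply: nP.
Qed.

End Amalgamation.

(** * Assembly of the tree and of the uniformizations *)

Theorem mainTheorem18 (d : Order.disp_t) (W : orderType d)
    (W_omega1 : is_omega1 W) (W_diamond : diamond W)
    (F : set (ladder_colouring W)) (F_card : F #= [set: W]) :
  exists (d' : Order.disp_t) (T : porderType d'),
    suslin_tree W T /\
    forall f : ladder_colouring W, F f ->
      exists phi : T -> nat, full_uniformization (projT2 f) phi.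
Proof.
have [fam famP] : exists fam : W -> ladder_colouring W, forall f, F f -> exists i, fam i = f.
  have /card_bijP[h [g gK hK]] := F_card.
  exists (fun i => val (g (to_setT i))) => f Ff.
  exists (val (h (SigSub (mem_set Ff)))).
  suff -> : to_setT (val (h (SigSub (mem_set Ff)))) = h (SigSub (mem_set Ff)) by rewrite gK.
  exact: val_inj.
have [en en_inj] := choice (fun alpha : W =>
  elimT (countable_injP _) (countable_below W_omega1 alpha)).
have [dec decP] := choice (fun xi : W => decoding (countable_below W_omega1 xi)).
have [v vP] : {v : W -> W -> nat & forall alpha xi, xi < alpha -> forall i, i < xi ->
    counted en alpha i xi -> dec xi (v alpha xi) i = col (fam i) alpha xi}.
  have [v vP] := choice (fun p : W * W => amalgam_colour fam en_inj decP p.1 p.2).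
  by exists (fun alpha xi => v (alpha, xi)) => alpha xi; apply: (vP (alpha, xi)).
have [g gP] := choice (fun i : W => countable_uniformization W_omega1 (fam i) i).
have [G [_ G_guess]] := W_diamond.
have [c c_inj] := omega1_mul_nat W_omega1.
have exE (alpha : W) : exists ea : nat -> W * nat * nat, below alpha !=set0 ->
    (forall k, (ea k).1.1 < alpha) /\
    forall delta j n, delta < alpha -> exists k, ea k = (delta, j, n).
  have [[b0 b0a]|ne] := pselect (below alpha !=set0); last first.
    by exists (fun=> (alpha, 0, 0)).
  have cX : countable (below alpha `*` [set: nat] `*` [set: nat]).
    by do 2 apply: countableX => //; apply: countable_below.
  have [|a [aA a_surj]] := countable_enum cX; first by exists (b0, 0, 0).
  exists a => _; split=> [k|delta j n da]; first by have [[]] := aA k.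
  exact: a_surj.
have [e eP] := choice exE.
pose P := admissible W_omega1 G (amalgam fam en) v c e.
have e_lt alpha (ne : below alpha !=set0) := (eP alpha ne).1.
have e_surj alpha delta j n (h : delta < alpha) :=
  (eP alpha (ex_intro (below alpha) _ h)).2 delta j n h.
have E_fin := amalgam_fin fam en_inj.
have P_ext := @admissible_ext _ _ W_omega1 G (amalgam fam en) v c e.
have P_down := @admissible_down _ _ W_omega1 G _ v E_fin c e e_lt e_surj.
exists seqtree_display, (seqtree P); split.
  exact: (@admissible_suslin _ _ W_omega1 G _ v E_fin c e e_lt e_surj c_inj G_guess).
move=> f /famP[i <-].
(* For a limit [alpha <= i] only heights below [i] matter, and [g i] serves; for [alpha > i] almost
   all points of the ladder exceed [i], and the colour is decoded from the top value of the node. *)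
pose phi (s : seqtree P) := if ht s <= i then g i (ht s) else dec (ht s) (lab s (ht s)) i.
exists phi => s alpha /(seqtree_heightE W_omega1 P_ext P_down) hs.
have lim : limit_ord W (val alpha) by apply: set_valP.
have [zeta [za zP]] : exists zeta, zeta < val alpha /\ forall xi,
    lad (fam i) (val alpha) xi -> zeta < xi -> phi (restr s xi) = col (fam i) (val alpha) xi.
  have rP xi : lad (fam i) (val alpha) xi ->
      ht (restr s xi) = xi /\ lab (restr s xi) xi = lab s xi.
    by move=> /lad_lt xa; apply: (seqtree_restr W_omega1 P_ext P_down); rewrite hs.
  case: (leP (val alpha) i) => [ai|ia].
    have [z [za zP]] := gP i _ lim ai; exists z; split=> // xi lx zx.
    have [hx _] := rP xi lx; rewrite /phi hx zP // ifT //.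
    exact: le_trans (ltW (lad_lt lx)) ai.
  (* Past [z1] the points of the ladder belong to the amalgam; past [z2] the branch through [s]
     takes the coded values there. *)
  have [z1 [iz1 z1a z1P]] := counted_large en_inj ia.
  have [|z2 [z2a z2P]] := @admissible_limit _ _ W_omega1 G _ v E_fin c e e_lt e_surj s.
    by rewrite hs.
  rewrite hs in z2a z2P.
  exists (Order.max z1 z2); split; first by rewrite gt_max z1a z2a.
  move=> xi lx; rewrite gt_max => /andP[z1x z2x].
  have ix : i < xi := le_lt_trans iz1 z1x.
  have xa := lad_lt lx.
  have [hx lbx] := rP xi lx; rewrite /phi hx leNgt ix /= lbx z2P //.
    exact: vP xa _ ix (z1P _ z1x).
  by exists i; split=> //; apply: z1P.
(* The exceptional set lives in a subtype; [val] carries it into the finite part of the ladder up to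
   [zeta]. *)
have val_inj' : {in [set xi : projT1 (fam i) alpha |
    phi (restr s (val xi)) <> projT2 (fam i) alpha xi] &, injective val}.
  by move=> x y _ _; apply: val_inj.
rewrite -(eq_finite_set (inj_card_eq val_inj')).
apply: sub_finite_set (lad_fin (fam i) za) => _ [xi /= ne <-].
have lx : lad (fam i) (val alpha) (val xi) by rewrite ladE; apply: set_valP.
split=> //; rewrite leNgt; apply/negP => zx; apply: ne.
by rewrite zP // colE.
Qed.
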